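(* Let $\mathbb{K}$ be a Galois number field of degree $n$, let $G=\operatorname{Gal}(\mathbb{K}/\mathbb{Q})$ be its Galois group, let $M$ be a $\mathbb{Z}$-submodule of $\mathbb{K}$ of rank $k\le n$, and let $G_M=\{\tau|_M:\tau\in G\}$. Then: (1) $G_M$ is a group if and only if $M$ is $G$-stable; (2) if $G_M$ is a group, then $|G_M|$ divides $|G|$; (3) if $G_M$ is a group and $G$ is cyclic, then $G_M$ is cyclic.
   Context: A Galois number field is a number field $\mathbb{K}$ such that $\mathbb{K}/\mathbb{Q}$ is Galois. $\tau|_M$ denotes the restriction of $\tau$ to $M$, a map $M\to\mathbb{K}$. Saying that $G_M$ is a group means that composition is a well-defined operation on $G_M$ (for all $\tau,\tau'\in G$ one has $\tau'(M)\subseteq M$, so that $\tau|_M\circ\tau'|_M$ makes sense, and this composite lies in $G_M$) which makes $G_M$ a group. $M$ is $G$-stable if $\tau(M)\subseteq M$ for all $\tau\in G$ (equivalently $\tau(M)=M$ for all $\tau\in G$). *)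

(* Defs.v *)
From HB Require Import structures.
From mathcomp Require Import all_boot all_order all_fingroup all_algebra.
From mathcomp Require Import all_solvable all_field.
From mathcomp Require Import finmap.
From mathcomp Require Import boolp classical_sets functions cardinality.

Set Implicit Arguments.
Unset Strict Implicit.
Unset Printing Implicit Defensive.

Import Order.TTheory GRing.Theory Num.Theory.

Local Open Scope classical_set_scope.
Local Open Scope ring_scope.

Definition Zfree (V : zmodType) (m : nat) (v : 'I_m -> V) : Prop :=
  forall c : 'I_m -> int, \sum_(i < m) v i *~ c i = 0 -> forall i, c i = 0.

(* The rank of a subgroup is the maximal size of a Z-linearly independent
   family; M need not be finitely generated. *)
Definition has_Zrank (V : zmodType) (M : set V) (k : nat) : Prop :=
  (exists2 v : 'I_k -> V, (forall i, M (v i)) & Zfree v) /\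
  (forall (m : nat) (v : 'I_m -> V), (forall i, M (v i)) -> Zfree v ->
    (m <= k)%N).

Definition is_group_under (T : Type) (op : T -> T -> T) (H : set T) : Prop :=
  [/\ forall f g, H f -> H g -> H (op f g),
      forall f g h, H f -> H g -> H h -> op f (op g h) = op (op f g) h
    & exists2 e, H e &
        (forall f, H f -> op e f = f /\ op f e = f) /\
        (forall f, H f -> exists2 g, H g & op f g = e /\ op g f = e)].

(* As for [cyclic] on finite groups: H is the smallest subgroup containing
   some element g. *)
Definition is_cyclic_under (T : Type) (op : T -> T -> T) (H : set T) : Prop :=
  is_group_under op H /\
  exists2 g, H g &
    forall H' : set T, H' `<=` H -> is_group_under op H' -> H' g -> H' = H.

Section RestrictedGaloisGroup.
Variables (K : splittingFieldType rat) (M : set K).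

Definition Gstable : Prop :=
  forall tau : gal_of {:K}, tau \in 'Gal({:K} / 1)%g -> tau @` M `<=` M.

(* Maps are functions on the subtype of elements of M, so two automorphisms
   agreeing on M give the same element. *)
Definition restrGal : set (M -> K) :=
  [set sigL M tau | tau in [set tau : gal_of {:K} | tau \in 'Gal({:K} / 1)%g]].

(* The value 0 is a default, used only where g leaves M. *)
Definition restr_comp (f g : M -> K) : M -> K :=
  fun x => oapp f 0 (insub (g x)).

Definition restr_comp_defined : Prop :=
  forall g, restrGal g -> forall x : M, M (g x).

Definition restrGal_is_group : Prop :=
  restr_comp_defined /\ is_group_under restr_comp restrGal.

Definition restrGal_is_cyclic : Prop :=
  restr_comp_defined /\ is_cyclic_under restr_comp restrGal.

End RestrictedGaloisGroup.

Arguments restrGal {K} M _.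

(* Main.v *)
(* Restriction to M turns composition in the Galois group into [restr_comp]
   as soon as M is stable, so G_M is a homomorphic image of G (up to the
   reversal of products, since the product of [gal_of] composes left to
   right): this gives the group structure and cyclicity. The fibres of the
   restriction are the right cosets of the pointwise stabiliser of M, whence
   the divisibility. *)
Require Import Defs.
From HB Require Import structures.
From mathcomp Require Import all_boot all_order all_fingroup all_algebra.
From mathcomp Require Import all_solvable all_field.
From mathcomp Require Import finmap.
From mathcomp Require Import boolp classical_sets functions cardinality.

Set Implicit Arguments.
Unset Strict Implicit.
Unset Printing Implicit Defensive.

Import Order.TTheory GRing.Theory Num.Theory.

Local Open Scope classical_set_scope.
Local Open Scope ring_scope.

(** The hypothesis on [f] makes it constant on each right coset of [H] in [G] and separates distinct
    cosets, so its values correspond to the cosets. *)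
Lemma card_fset_set_rcosets (gT : finGroupType) (T : choiceType)
    (G H : {group gT}) (f : gT -> T) :
    H \subset G ->
    {in G &, forall x y, f x = f y <-> (x * y^-1)%g \in H} ->
  #|` fset_set (f @` [set x : gT | x \in G])| = #|G : H|%g.
Proof.
move=> sHG fE.
have reprG A : A \in rcosets H G -> repr A \in G /\ (H :* repr A)%g = A.
  case/rcosetsP=> x Gx ->; split; last exact: rcoset_repr.
  have /rcosetP[h Hh ->] := mem_repr_rcoset H x.
  by rewrite groupM ?(fintype.subsetP sHG _ Hh).
(* Evaluating [f] at a chosen representative turns it into a function of the coset. *)
have -> : f @` [set x : gT | x \in G] =
    (f \o repr) @` [set A : {set gT} | A \in rcosets H G].
  apply/seteqP; split=> _ [x /= Gx <-].
    have HxG : (H :* x)%g \in rcosets H G by rewrite mem_rcosets mulSGid.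
    exists (H :* x)%g => //=; have [Gr /rcoset_eqP] := reprG _ HxG.
    by move=> Hr; apply/fE => //; rewrite -mem_rcoset.
  by have [Gr _] := reprG _ Gx; exists (repr x).
have fin_rcosets : finite_set [set A : {set gT} | A \in rcosets H G].
  exact: finite_finset.
(* Injectivity: equal values put both representatives in one right coset, and each coset is
   recovered from its representative. *)
rewrite fset_set_image // card_in_imfset /=; last first.
  move=> A B; rewrite !in_fset_set // !inE => /reprG[GA {2}<-] /reprG[GB {2}<-].
  by move=> /fE -/(_ GA GB); rewrite -mem_rcoset => /rcoset_eqP.
rewrite -[RHS]/(#|rcosets H G|) cardE.
apply/perm_size/uniq_perm; rewrite ?fset_uniq ?enum_uniq // => A.
by rewrite in_fset_set // mem_enum; apply/idP/idP; rewrite inE.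
Qed.

Section Restriction.
Variables (K : splittingFieldType rat) (M : set K).
Local Notation G := 'Gal({:K} / 1)%g.

Lemma galM_fullE (s t : gal_of {:K}) a : (s * t)%g a = t (s a).
Proof. by rewrite galM ?memvf. Qed.

(** [M] is an arbitrary classical set, so the fixing condition is made boolean to give a finite
    set. *)
Definition pointwise_stab : {set gal_of {:K}} :=
  [set t in G | `[< forall a, M a -> t a = a >]].

Lemma pointwise_stab_group_set : group_set pointwise_stab.
Proof.
apply/group_setP; split=> [|s t].
  by rewrite inE group1; apply/asboolP => a _; rewrite gal_id.
rewrite !inE => /andP[Gs /asboolP sM] /andP[Gt /asboolP tM].
by rewrite groupM //; apply/asboolP => a Ma; rewrite galM_fullE sM ?tM.
Qed.
Canonical pointwise_stab_group := Group pointwise_stab_group_set.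

Lemma sigL_gal_eq : {in G &, forall s t : gal_of {:K},
  sigL M s = sigL M t <-> (s * t^-1)%g \in pointwise_stab}.
Proof.
move=> s t Gs Gt; rewrite inE groupM ?groupV //=; split.
  move=> st; apply/asboolP => a Ma; rewrite galM_fullE.
  have := congr1 (fun f : M -> K => f (SigSub (mem_set Ma))) st.
  by rewrite !sigLE => ->; rewrite -galM_fullE mulgV gal_id.
move/asboolP=> fixM; apply/funext => -[a Ma]; rewrite !sigLE.
(* In [t a], the point [a] is replaced by its equal [(s * t^-1) a]; applying [t] then cancels [t^-1]
   and leaves [s a]. *)
by rewrite -[in RHS](fixM _ (set_mem Ma)) -galM_fullE mulgKV.
Qed.

Lemma dvdn_card_restrGal : (#|` fset_set (restrGal M)| %| #|G|)%N.
Proof.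
rewrite (card_fset_set_rcosets _ sigL_gal_eq) ?dvdn_indexg //.
by apply/fintype.subsetP => t; rewrite inE => /andP[].
Qed.

Lemma restr_comp_definedE : restr_comp_defined M <-> Gstable M.
Proof.
split=> [def t Gt _ [a Ma <-]|stab _ [t Gt <-] x].
  by have := def (sigL M t) (ex_intro2 _ _ t Gt erefl) (SigSub (mem_set Ma)).
by apply: stab Gt _ _; exists (val x) => //; apply/set_mem/valP.
Qed.

Hypothesis stab : Gstable M.

Lemma restr_comp_gal (s t : gal_of {:K}) : t \in G ->
  restr_comp (sigL M s) (sigL M t) = sigL M (t * s)%g.
Proof.
move=> Gt; apply/funext => -[a Ma]; rewrite /restr_comp !sigLE.
(* Stability makes [insub] succeed, so the default value 0 of [restr_comp] is never reached. *)
have Mta : t a \in M by apply/mem_set/(stab Gt); exists a => //; apply/set_mem.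
by rewrite (insubT (fun b => b \in M) Mta) /= galM_fullE.
Qed.

Lemma restrGal_group : is_group_under (@restr_comp K M) (restrGal M).
Proof.
split.
- move=> _ _ [s Gs <-] [t Gt <-]; rewrite restr_comp_gal //.
  by exists (t * s)%g => //=; rewrite groupM.
- move=> _ _ _ [s Gs <-] [t Gt <-] [u Gu <-].
  by rewrite !restr_comp_gal ?groupM ?mulgA.
- exists (sigL M (1%g : gal_of {:K})); first by exists 1%g => //=; rewrite group1.
  split=> _ [s Gs <-]; first by rewrite !restr_comp_gal ?group1 ?mulg1 ?mul1g.
  exists (sigL M (s^-1)%g); first by exists s^-1%g => //=; rewrite groupV.
  by rewrite !restr_comp_gal ?groupV ?mulgV ?mulVg.
Qed.

Lemma restrGal_cyclic : cyclic G ->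
  is_cyclic_under (@restr_comp K M) (restrGal M).
Proof.
case/cyclicP=> g defG; have Gg : g \in G by rewrite defG cycle_id.
split; first exact: restrGal_group.
exists (sigL M g); first by exists g.
move=> H' sub [H'comp _ _] H'g; apply/seteqP; split=> // _ [t + <-] /=.
(* Closure under composition, starting from [g] itself, yields the positive powers. *)
have H'X i : H' (sigL M (g ^+ i.+1)%g).
  elim: i => [|i IHi]; first by rewrite expg1.
  by rewrite expgS -restr_comp_gal //; apply: H'comp.
rewrite /= defG => /cycleP[[|i] ->]; last exact: H'X.
(* The identity is also a positive power: it equals [g ^+ #[g]], and the order is at least 1. *)
by rewrite expg0 -(expg_order g) -(prednK (order_gt0 g)).
Qed.

End Restriction.

Theorem lemma10 (n k : nat) (K : splittingFieldType rat)
    (hgal : galois 1 {:K}) (hn : \dim {:K} = n)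
    (M : set K) (hM : zmod_closed (mem M)) (hk : has_Zrank M k)
    (hkn : (k <= n)%N) :
  [/\ restrGal_is_group M <-> Gstable M,
      restrGal_is_group M ->
        (#|` fset_set (restrGal M)| %| #|'Gal({:K} / 1)%g|)%N
    & restrGal_is_group M -> cyclic 'Gal({:K} / 1)%g ->
        restrGal_is_cyclic M].
Proof.
(* The well-definedness clause of [restrGal_is_group] is stability in another form; conversely,
   stability yields the group laws. *)
have isgrpE : restrGal_is_group M <-> Gstable M.
  split=> [[/restr_comp_definedE]//|stab].
  by split; [exact/restr_comp_definedE|exact: restrGal_group].
split=> // [_|/isgrpE stab cycG]; first exact: dvdn_card_restrGal.
by split; [exact/restr_comp_definedE|exact: restrGal_cyclic].
Qed.
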